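(* Assume the abc conjecture: for every $\varepsilon>0$ there is $C_\varepsilon$ such that for all coprime positive integers $a,b$ one has $a+b<C_\varepsilon\cdot \mathrm{rad}(ab(a+b))^{1+\varepsilon}$. Then for any positive integers $A,B,C$ and any real numbers $F,Q,M$ with $F<1$, the equation $$A\cdot X+B\cdot Y=C\cdot Z$$ has only finitely many solutions $(X,Y,Z)$ in products $X,Y,Z$ of degrees $n_X,n_Y,n_Z$, spreads $s_X,s_Y,s_Z$ and bases $b_X,b_Y,b_Z$, respectively, satisfying $$\frac{s_X^2}{b_X},\ \frac{s_Y^2}{b_Y},\ \frac{s_Z^2}{b_Z}\leq M,$$ $$\frac{1+s_X}{n_X}+\frac{1+s_Y}{n_Y}+\frac{1+s_Z}{n_Z}\leq F,$$ and $$\frac{\gcd(X,Y)}{\mathrm{rad}(\gcd(X,Y))}\leq Q.$$ Here the degrees, spreads and bases are not fixed: finiteness is over all possible degrees $n_X,n_Y,n_Z$ and spreads satisfying these conditions, and solutions are counted as triples of integer values $(X,Y,Z)$.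
   Context: A product is an expression $X=x_1\cdots x_n$ with $n\geq 1$ and $x_1,\dots,x_n$ positive integers (repetitions allowed); $X$ also denotes its integer value. Its degree is $n$ (denoted $n_X$), its spread is $s_X=\max(x_1,\dots,x_n)-\min(x_1,\dots,x_n)$, and its base is $b_X=\min(x_1,\dots,x_n)$. The same integer may be written as a product in several ways, with different degrees, spreads and bases. For a positive integer $g$, $\mathrm{rad}(g)$ denotes the product of the distinct prime divisors of $g$ (so $\mathrm{rad}(1)=1$). *)

(* Defs.v *)
From mathcomp Require Import all_boot all_order all_algebra.
From mathcomp Require Import all_classical all_reals exp.

Set Implicit Arguments.
Unset Strict Implicit.
Unset Printing Implicit Defensive.

Import Order.TTheory GRing.Theory Num.Theory.

Local Open Scope ring_scope.

(* An expression x_1 ... x_n, kept distinct from the integer it denotes. *)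
Record product := Product {
  factors :> seq nat;
  productP : (0 < size factors)%N && all (fun x => 0 < x)%N factors
}.

Definition value (X : product) : nat := (\prod_(x <- X) x)%N.

Definition degree (X : product) : nat := size X.

(* The initial value of the iterated minimum is itself one of the factors. *)
Definition base (X : product) : nat := \big[minn/head 0%N X]_(x <- X) x.

Definition spread (X : product) : nat := ((\max_(x <- X) x) - base X)%N.

Definition nat_rad (g : nat) : nat := (\prod_(p <- primes g) p)%N.

Definition abc_conjecture (R : realType) : Prop :=
  forall eps : R, 0 < eps ->
  exists K : R, forall a b : nat, (0 < a)%N -> (0 < b)%N -> coprime a b ->
    (a + b)%N%:R < K * (nat_rad (a * b * (a + b))%N)%:R `^ (1 + eps).

(* Main.v *)
Require Import Defs.
From mathcomp Require Import all_boot all_order all_algebra.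
From mathcomp Require Import all_classical all_reals exp.
From mathcomp Require Import ring lra sequences.

(** The factors of a product [X] of degree [n], base [b] and spread [s] lie
    among the [1 + s] integers [b, ..., b + s], so
    [rad X <= (b + s) ^ (1 + s)] however large [n] is, whereas
    [X >= b ^ n].  The bound on [s ^ 2 / b] makes [(1 + s / b) ^ (1 + s)]
    bounded, and hence [rad X <= D * X ^ ((1 + s) / n)] with [D] depending on
    [M] only ([nat_rad_value_le]).

    Put [T = C Z], the largest of the three terms, and [g = gcd(X, Y)].
    Dividing the equation by [G = gcd(A X, B Y)] gives coprime [a], [b] with
    [a + b = T / G], to which the abc conjecture applies.  Two remarks about
    [g] keep the division harmless.  On one hand [G <= A B g <= A B Q rad g].
    On the other hand each prime of [g] divides both [X] and [Y], so that
    [rad (X Y) * rad g = rad X * rad Y] and therefore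
    [rad g * rad (a b (a + b)) <= A B C * rad X * rad Y * rad Z]
    ([nat_rad_reduced_le]).  The factor [rad g] lost in the first estimate
    is thus recovered in the second, and abc yields
    [T <= L * T ^ (F (1 + eps))] with [L] independent of the solution.  As
    [F < 1], the choice [eps = (1 - F) / 2] makes the exponent smaller than 1,
    which bounds [T] and with it [X], [Y] and [Z]. *)

Set Implicit Arguments.
Unset Strict Implicit.
Unset Printing Implicit Defensive.

Import Order.TTheory GRing.Theory Num.Theory.

(** * The radical *)

(** A common index set for the radicals of all divisors of [N], which turns
    relations between such radicals into relations prime by prime. *)
Lemma nat_radE N n : (0 < N)%N -> (n %| N)%N ->
  nat_rad n = (\prod_(p <- primes N) if (p %| n)%N then p else 1)%N.
Proof.
move=> N0 nN; have n0 := dvdn_gt0 N0 nN.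
rewrite -big_mkcond -[RHS]big_filter; apply: perm_big; apply: uniq_perm.
- exact: primes_uniq.
- exact/filter_uniq/primes_uniq.
move=> p; rewrite mem_filter !mem_primes N0 n0 /=.
by case pn: (p %| n)%N; rewrite /= ?andbF // (dvdn_trans pn nN).
Qed.

Lemma nat_rad_gt0 n : (0 < nat_rad n)%N.
Proof.
rewrite /nat_rad big_seq; apply: prodn_cond_gt0 => p.
by rewrite mem_primes => /andP[/prime_gt0].
Qed.

Lemma nat_rad_le n : (0 < n)%N -> (nat_rad n <= n)%N.
Proof.
move=> n0; rewrite [leqRHS]prod_prime_decomp // prime_decompE big_map /=.
rewrite /nat_rad big_seq [leqRHS]big_seq; apply: leq_prod => p pn.
have : (0 < logn p n)%N by rewrite logn_gt0.
case: (logn p n) => // e _; rewrite expnS leq_pmulr // expn_gt0.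
by move: pn; rewrite mem_primes => /andP[/prime_gt0->].
Qed.

Lemma nat_rad_mono m n : (0 < m)%N -> (0 < n)%N ->
  (forall p, prime p -> (p %| m)%N -> (p %| n)%N) ->
  (nat_rad m <= nat_rad n)%N.
Proof.
move=> m0 n0 mn.
rewrite (@nat_radE (m * n) m) ?muln_gt0 ?m0 // ?dvdn_mulr //.
rewrite (@nat_radE (m * n) n) ?muln_gt0 ?m0 // ?dvdn_mull //.
rewrite big_seq [leqRHS]big_seq.
apply: leq_prod => p; rewrite mem_primes => /andP[pp _].
case: ifP => [/(mn _ pp)->//|_]; by case: ifP => // _; exact: prime_gt0.
Qed.

(** A prime dividing both [m] and [n] divides both numbers on the left, one
    dividing only one of them divides [m * n] alone. *)
Lemma nat_radM_gcd m n : (0 < m)%N -> (0 < n)%N ->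
  (nat_rad (m * n) * nat_rad (gcdn m n) = nat_rad m * nat_rad n)%N.
Proof.
move=> m0 n0; have N0 : (0 < m * n)%N by rewrite muln_gt0 m0.
have gN : (gcdn m n %| m * n)%N by rewrite dvdn_mulr ?dvdn_gcdl.
have mN := dvdn_mulr n (dvdnn m); have nN := dvdn_mull m (dvdnn n).
rewrite !(nat_radE N0) ?gN ?mN ?nN //.
rewrite -!big_split /=.
apply: eq_big_seq => p; rewrite mem_primes => /andP[pp _].
rewrite Euclid_dvdM // dvdn_gcd.
by case: (p %| m)%N; case: (p %| n)%N; rewrite /= ?muln1 ?mul1n.
Qed.

Lemma nat_radM_le m n : (0 < m)%N -> (0 < n)%N ->
  (nat_rad (m * n) <= nat_rad m * nat_rad n)%N.
Proof. by move=> m0 n0; rewrite -nat_radM_gcd // leq_pmulr // nat_rad_gt0. Qed.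

(** Here [a], [b], [c] stand for [A X], [B Y], [C Z] divided by a common
    factor. *)
Lemma nat_rad_reduced_le A B C x y z a b c :
  (0 < A)%N -> (0 < B)%N -> (0 < C)%N -> (0 < x)%N -> (0 < y)%N -> (0 < z)%N ->
  (a %| A * x)%N -> (b %| B * y)%N -> (c %| C * z)%N ->
  (nat_rad (gcdn x y) * nat_rad (a * b * c)
   <= A * B * C * (nat_rad x * nat_rad y * nat_rad z))%N.
Proof.
move=> A0 B0 C0 x0 y0 z0 aA bB cC.
have ABC0 : (0 < A * B * C)%N by rewrite !muln_gt0 A0 B0.
have xy0 : (0 < x * y)%N by rewrite muln_gt0 x0.
have xyz0 : (0 < x * y * z)%N by rewrite muln_gt0 xy0.
have dv : (a * b * c %| A * B * C * (x * y * z))%N.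
  by rewrite [X in (_ %| X)%N](_ : _ = A * x * (B * y) * (C * z))%N;
    [rewrite !dvdn_mul | ring].
have N0 : (0 < A * B * C * (x * y * z))%N by rewrite muln_gt0 ABC0.
have le1 : (nat_rad (a * b * c) <= A * B * C * (nat_rad (x * y) * nat_rad z))%N.
  apply: (@leq_trans (nat_rad (A * B * C * (x * y * z)))).
    apply: nat_rad_mono => // [|p _ /dvdn_trans->//].
    exact: dvdn_gt0 dv.
  apply: (leq_trans (nat_radM_le ABC0 xyz0)).
  by rewrite leq_mul // ?nat_rad_le // nat_radM_le.
apply: (@leq_trans (nat_rad (gcdn x y) *
                    (A * B * C * (nat_rad (x * y) * nat_rad z)))%N).
  by rewrite leq_mul2l le1 orbT.
rewrite -(nat_radM_gcd x0 y0) eq_leq //; ring.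
Qed.

(** * Products of small spread *)

Lemma factor_gt0 (X : product) x : x \in factors X -> (0 < x)%N.
Proof. by case/andP: (productP X) => _ /allP; apply. Qed.

Lemma value_gt0 X : (0 < value X)%N.
Proof. by rewrite /value big_seq prodn_cond_gt0 // => x /factor_gt0. Qed.

Lemma degree_gt0 X : (0 < degree X)%N.
Proof. by case/andP: (productP X). Qed.

Lemma base_gt0 X : (0 < base X)%N.
Proof.
have X0 := degree_gt0 X.
have h0 : (0 < head 0%N X)%N.
  apply: (@factor_gt0 X); move: X0; rewrite /degree.
  by case: (factors X) => //= *; rewrite mem_head.
rewrite /base big_seq; elim/big_ind: _ => // [m n m0 n0|x /factor_gt0//].
by rewrite leq_min m0.
Qed.

Lemma base_le (X : product) x : x \in factors X -> (base X <= x)%N.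
Proof.
rewrite /base; elim: (factors X) (head _ _) => // y s IH h.
rewrite inE big_cons geq_min => /predU1P[->|/IH->]; by rewrite ?leqnn ?orbT.
Qed.

Lemma factor_le (X : product) x :
  x \in factors X -> (x <= base X + spread X)%N.
Proof.
move=> xX; rewrite /spread -leq_subLR; apply: leq_sub2r.
exact: (@leq_bigmax_seq _ (factors X) xpredT id).
Qed.

Lemma expn_base_le X : (base X ^ degree X <= value X)%N.
Proof.
rewrite /value /degree -sum1_size expn_sum big_seq [leqRHS]big_seq.
exact/leq_prod/base_le.
Qed.

(** The factors of [X] divide [base X * ... * (base X + spread X)], which
    consequently has every prime divisor of [X]. *)
Lemma nat_rad_value_le_expn X :
  (nat_rad (value X) <= (base X + spread X) ^ (spread X).+1)%N.
Proof.
set b := base X; set s := spread X.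
have W0 : (0 < \prod_(i < s.+1) (b + i))%N.
  by rewrite prodn_gt0 // => i; rewrite addn_gt0 base_gt0.
apply: (@leq_trans (\prod_(i < s.+1) (b + i))%N).
  apply: leq_trans (nat_rad_le W0).
  apply: nat_rad_mono W0 _; first exact: value_gt0.
  move=> p pp; rewrite /value Euclid_dvd_prod // big_has => /hasP[x xX px].
  have bx := base_le xX; have xb := factor_le xX.
  have xs : (x - b < s.+1)%N by rewrite ltnS leq_subLR.
  apply: dvdn_trans px _; rewrite (bigD1 (Ordinal xs)) //= subnKC //.
  exact: dvdn_mulr.
rewrite -[X in (_ ^ X)%N]card_ord -prod_nat_const; apply: leq_prod => i _.
by rewrite leq_add2l -ltnS.
Qed.

Local Open Scope classical_set_scope.
Local Open Scope ring_scope.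

(** Use [(1 + s / b) ^ (1 + s) <= exp (s (1 + s) / b)] for the deviation of the
    factors from [b], and [b ^ (1 + s) = (b ^ n) ^ ((1 + s) / n)] for the main
    part. *)
Lemma nat_rad_value_le (R : realType) (M : R) X :
  (spread X)%:R ^+ 2 / (base X)%:R <= M ->
  (nat_rad (value X))%:R <=
    expR (2 * M) * (value X)%:R `^ ((1 + (spread X)%:R) / (degree X)%:R).
Proof.
have := nat_rad_value_le_expn X; have := expn_base_le X.
have := base_gt0 X; have := degree_gt0 X; have := value_gt0 X.
set b := base X; set s := spread X; set n := degree X; set v := value X.
set r := nat_rad v => v0 n0 b0 bv rb sM.
have b0R : 0 < b%:R :> R by rewrite ltr0n.
have n0R : 0 < n%:R :> R by rewrite ltr0n.
have expM : (1 + s%:R / b%:R) ^+ s.+1 <= expR (2 * M) :> R.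
  apply: (@le_trans _ _ (expR (s%:R / b%:R) ^+ s.+1)).
    rewrite lerXn2r ?nnegrE ?expR_ge0 ?expR_ge1Dx //.
    by rewrite addr_ge0 // divr_ge0.
  rewrite -expRM_natr ler_expR.
  apply: (@le_trans _ _ (2 * (s%:R ^+ 2 / b%:R))); last by rewrite ler_pM2l.
  rewrite mulrAC mulrA ler_pM2r ?invr_gt0 // -natrX -!natrM ler_nat.
  (* [s * (s + 1) <= 2 * s ^ 2] also when [s = 0]. *)
  case: (s) => // k; rewrite mul2n -addnn mulnS addnC leq_add //.
  by rewrite expnS leq_pmulr.
have bvR : b%:R ^+ s.+1 <= v%:R `^ ((1 + s%:R) / n%:R) :> R.
  rewrite -powR_mulrn // -natr1 addrC.
  rewrite -[X in _ `^ X <= _](@divfK _ n%:R) ?lt0r_neq0 // mulrC powRrM.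
  rewrite powR_mulrn //.
  rewrite ge0_ler_powR ?nnegrE ?exprn_ge0 //.
    by rewrite divr_ge0 // addr_ge0.
  by rewrite -natrX ler_nat.
apply: (@le_trans _ _ ((b + s) ^ s.+1)%:R); first by rewrite ler_nat.
have -> : ((b + s) ^ s.+1)%:R = (1 + s%:R / b%:R) ^+ s.+1 * b%:R ^+ s.+1 :> R.
  by rewrite -exprMn natrX natrD mulrDl mul1r divfK // lt0r_neq0.
by rewrite ler_pM // exprn_ge0 // addr_ge0 // divr_ge0.
Qed.

(** * Bounding the solutions *)

Lemma powR_gap_bound (R : realType) (T L d : R) :
  1 <= T -> 0 < d -> T <= L * T `^ (1 - d) -> T <= L `^ d^-1.
Proof.
move=> T1 d0 TL; have T0 : 0 < T by lra.
have TdL : T `^ d <= L.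
  rewrite -(ler_pM2r (powR_gt0 (1 - d) T0)) -powRD ?(gt_eqF T0) ?implybT //.
  by rewrite addrC subrK powRr1 // ltW.
rewrite -[T in T <= _](powRr1 (ltW T0)) -(mulfV (lt0r_neq0 d0)) powRrM.
rewrite ge0_ler_powR ?nnegrE ?invr_ge0 ?(ltW d0) ?powR_ge0 //.
exact: le_trans (powR_ge0 T d) TdL.
Qed.

(** The triple to which abc applies is smaller than [(A x, B y, C z)] by the
    factor [gcdn (A * x) (B * y)], at most [A * B * Q * nat_rad (gcdn x y)].
    Since [1 + eps >= 1], the radical of [gcdn x y] can be moved under the
    power, where [nat_rad_reduced_le] absorbs it. *)
Lemma abc_term_le (R : realType) (eps K Q : R) (A B C x y z : nat) :
  0 < eps ->
  (forall a b : nat, (0 < a)%N -> (0 < b)%N -> coprime a b ->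
    (a + b)%N%:R < K * (nat_rad (a * b * (a + b))%N)%:R `^ (1 + eps)) ->
  (0 < A)%N -> (0 < B)%N -> (0 < C)%N -> (0 < x)%N -> (0 < y)%N -> (0 < z)%N ->
  (A * x + B * y = C * z)%N ->
  (gcdn x y)%:R / (nat_rad (gcdn x y))%:R <= Q ->
  (C * z)%:R <= (A * B)%:R * `|Q| * `|K| *
    (A * B * C * (nat_rad x * nat_rad y * nat_rad z))%:R `^ (1 + eps).
Proof.
move=> eps0 abc A0 B0 C0 x0 y0 z0 E gQ.
set g := gcdn x y in gQ *; set G := gcdn (A * x) (B * y).
have Ax0 : (0 < A * x)%N by rewrite muln_gt0 A0.
have By0 : (0 < B * y)%N by rewrite muln_gt0 B0.
have G0 : (0 < G)%N by rewrite gcdn_gt0 Ax0.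
set a := (A * x %/ G)%N; set b := (B * y %/ G)%N.
have aG : (a * G = A * x)%N by rewrite divnK // dvdn_gcdl.
have bG : (b * G = B * y)%N by rewrite divnK // dvdn_gcdr.
have a0 : (0 < a)%N by move: Ax0; rewrite -aG muln_gt0 => /andP[].
have b0 : (0 < b)%N by move: By0; rewrite -bG muln_gt0 => /andP[].
have ab : coprime a b.
  by rewrite /coprime -(eqn_pmul2r G0) muln_gcdl aG bG mul1n.
have cG : ((a + b) * G = C * z)%N by rewrite mulnDl aG bG.
have Gg : (G <= A * B * g)%N.
  apply: dvdn_leq; first by rewrite !muln_gt0 A0 B0 gcdn_gt0 x0.
  rewrite muln_gcdr dvdn_gcd; apply/andP; split.
    by apply: dvdn_trans (dvdn_gcdl _ _) _; rewrite mulnAC dvdn_mulr.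
  by apply: dvdn_trans (dvdn_gcdr _ _) _; rewrite -mulnA dvdn_mull.
have rg0 : 0 < (nat_rad g)%:R :> R by rewrite ltr0n nat_rad_gt0.
have gQR : g%:R <= `|Q| * (nat_rad g)%:R.
  by rewrite -ler_pdivrMr // (le_trans gQ) // ler_norm.
have GR : G%:R <= (A * B)%:R * `|Q| * (nat_rad g)%:R :> R.
  apply: (@le_trans _ _ ((A * B)%:R * g%:R)); first by rewrite -natrM ler_nat.
  by rewrite -mulrA ler_wpM2l.
have cR : (a + b)%:R <= `|K| * (nat_rad (a * b * (a + b)))%:R `^ (1 + eps).
  rewrite (le_trans (ltW (abc _ _ a0 b0 ab))) //.
  by rewrite ler_wpM2r ?powR_ge0 // ler_norm.
have rad_le : (nat_rad g)%:R * (nat_rad (a * b * (a + b)))%:R `^ (1 + eps) <=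
    (A * B * C * (nat_rad x * nat_rad y * nat_rad z))%:R `^ (1 + eps).
  apply: le_trans (le1r_powRZ _ _ _) _; rewrite ?ler1n ?nat_rad_gt0 //; first lra.
  rewrite ge0_ler_powR ?nnegrE ?mulr_ge0 //; first lra.
  rewrite -natrM ler_nat nat_rad_reduced_le //.
  - by rewrite -aG dvdn_mulr.
  - by rewrite -bG dvdn_mulr.
  - by rewrite -cG dvdn_mulr.
rewrite -cG natrM.
apply: le_trans (ler_pM _ _ cR GR) _ => //.
apply: le_trans (ler_wpM2l _ rad_le); last by rewrite !mulr_ge0.
by rewrite le_eqVlt; apply/orP; left; apply/eqP; ring.
Qed.

Theorem theorem12 (R : realType) (abc : abc_conjecture R)
    (A B C : nat) (A_gt0 : (0 < A)%N) (B_gt0 : (0 < B)%N) (C_gt0 : (0 < C)%N)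
    (F Q M : R) (F_lt1 : F < 1) :
  finite_set [set t : nat * nat * nat | exists X Y Z : product,
    [/\ t = (value X, value Y, value Z),
        (A * value X + B * value Y = C * value Z)%N,
        [/\ (spread X)%:R ^+ 2 / (base X)%:R <= M,
            (spread Y)%:R ^+ 2 / (base Y)%:R <= M &
            (spread Z)%:R ^+ 2 / (base Z)%:R <= M],
        (1 + (spread X)%:R) / (degree X)%:R
          + (1 + (spread Y)%:R) / (degree Y)%:R
          + (1 + (spread Z)%:R) / (degree Z)%:R <= F &
        (gcdn (value X) (value Y))%:R
          / (nat_rad (gcdn (value X) (value Y)))%:R <= Q]].
Proof.
pose eps : R := (1 - F) / 2.
have eps0 : 0 < eps by rewrite /eps; lra.
have [K abcK] := abc eps eps0.
pose D := expR (2 * M).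
pose P := (A * B * C)%:R * (D * D * D).
pose L := (A * B)%:R * `|Q| * `|K| * P `^ (1 + eps).
(* [F * (1 + eps) = 1 - d], by the choice of [eps]. *)
pose d : R := (1 - F) * (2 - F) / 2.
have d0 : 0 < d by rewrite /d divr_gt0 // mulr_gt0; lra.
pose N := Num.bound (L `^ d^-1).
apply: (@sub_finite_set _ _ (`I_N `*` `I_N `*` `I_N)); last first.
  by do 2!apply: finite_setX => //; exact: finite_II.
move=> _ [X [Y [Z [-> E [sX sY sZ] degF gQ]]]].
have x0 := value_gt0 X; have y0 := value_gt0 Y; have z0 := value_gt0 Z.
have rX := nat_rad_value_le sX; have rY := nat_rad_value_le sY.
have rZ := nat_rad_value_le sZ.
have := abc_term_le eps0 abcK A_gt0 B_gt0 C_gt0 x0 y0 z0 E gQ.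
move: E rX rY rZ; rewrite -/D => E rX rY rZ TL.
set T := (C * value Z)%N in E TL.
have xT : (value X <= T)%N.
  by rewrite -E (leq_trans (leq_pmull _ A_gt0)) // leq_addr.
have yT : (value Y <= T)%N.
  by rewrite -E (leq_trans (leq_pmull _ B_gt0)) // leq_addl.
have zT : (value Z <= T)%N by rewrite leq_pmull.
have T0 : (0 < T)%N by apply: leq_trans z0 zT.
have T1 : 1 <= T%:R :> R by rewrite ler1n.
have D0 : 0 <= D := expR_ge0 _.
have powT0 e : 0 <= T%:R `^ e :> R := powR_ge0 _ _.
have toT v e : (v <= T)%N -> 0 <= e -> v%:R `^ e <= T%:R `^ e :> R.
  by move=> vT e0; rewrite ge0_ler_powR ?nnegrE // ler_nat.
have exp_ge0 W : 0 <= (1 + (spread W)%:R) / (degree W)%:R :> R.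
  by rewrite divr_ge0 // addr_ge0.
have {}rX := le_trans rX (ler_wpM2l D0 (toT _ _ xT (exp_ge0 X))).
have {}rY := le_trans rY (ler_wpM2l D0 (toT _ _ yT (exp_ge0 Y))).
have {}rZ := le_trans rZ (ler_wpM2l D0 (toT _ _ zT (exp_ge0 Z))).
have PT : (A * B * C * (nat_rad (value X) * nat_rad (value Y) *
            nat_rad (value Z)))%:R <= P * T%:R `^ F.
  rewrite [in leLHS]natrM /P -mulrA ler_wpM2l // ![in leLHS]natrM.
  apply: le_trans (ler_pM _ _ (ler_pM _ _ rX rY) rZ) _; rewrite ?mulr_ge0 //.
  have D30 : 0 <= D * D * D by rewrite !mulr_ge0.
  apply: (le_trans _ (ler_wpM2l D30 (ler_powR T1 degF))).
  rewrite !powRD ?pnatr_eq0 ?(gtn_eqF T0) ?implybT //.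
  by rewrite le_eqVlt; apply/orP; left; apply/eqP; ring.
have P0 : 0 <= P by rewrite !mulr_ge0.
have TLd : T%:R <= L * T%:R `^ (1 - d).
  rewrite /L -mulrA; apply: le_trans TL _.
  rewrite ler_wpM2l ?mulr_ge0 //.
  rewrite [X in _ * _ `^ X](_ : 1 - d = F * (1 + eps)); last first.
    by rewrite /d /eps; field.
  rewrite powRrM -powRM ?powR_ge0 //.
  rewrite ge0_ler_powR ?nnegrE ?mulr_ge0 ?powR_ge0 //.
  by rewrite addr_ge0 // ltW.
have TN : (T < N)%N.
  rewrite -(ltr_nat R); apply: le_lt_trans (powR_gap_bound T1 d0 TLd) _.
  exact/archi_boundP/powR_ge0.
by split; [split|]; apply: leq_ltn_trans TN.
Qed.
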